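(* For a nonzero $x\in\mathbb Q(q^{1/2})$, the following formulas define an irreducible $U_q(B^{(1)}(0,n))^\sigma$-module structure on $\mathcal W$ (with $1\le j\le n-1$): $$e_0|\mathbf m\rangle=xq^{-1}\frac{[m_1+1][m_1+2]}{[2]}|\mathbf m+2\mathbf e_1\rangle,\quad f_0|\mathbf m\rangle=-x^{-1}\frac{q}{[2]}|\mathbf m-2\mathbf e_1\rangle,\quad k_0|\mathbf m\rangle=q^{2m_1+1}|\mathbf m\rangle,$$ $$e_j|\mathbf m\rangle=[m_{j+1}+1]\,|\mathbf m-\mathbf e_j+\mathbf e_{j+1}\rangle,\quad f_j|\mathbf m\rangle=[m_j+1]\,|\mathbf m+\mathbf e_j-\mathbf e_{j+1}\rangle,\quad k_j|\mathbf m\rangle=q^{-m_j+m_{j+1}}|\mathbf m\rangle,$$ $$e_n|\mathbf m\rangle=-q^{1/2}|\mathbf m-\mathbf e_n\rangle,\quad f_n|\mathbf m\rangle=q^{-1/2}[m_n+1]\,|\mathbf m+\mathbf e_n\rangle,\quad k_n|\mathbf m\rangle=q^{-m_n-1/2}|\mathbf m\rangle,$$ $$\sigma|\mathbf m\rangle=(-1)^{|\mathbf m|}|\mathbf m\rangle .$$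
   Context: Let $n\ge2$, $I=\{0,1,\dots,n\}$, $q$ an indeterminate, $[m]=\frac{q^m-q^{-m}}{q-q^{-1}}$. $\mathcal W$ is the $\mathbb Q(q^{1/2})$-vector space with basis $|\mathbf m\rangle$, $\mathbf m=(m_1,\dots,m_n)\in\mathbb Z_{\ge0}^n$; $|\mathbf m|=\sum_jm_j$; $\mathbf e_j$ is the $j$-th standard vector of $\mathbb Z^n$; a vector $|\mathbf m\rangle$ with a negative entry is understood as $0$. Data for $B^{(1)}(0,n)$: $a_{ii}=2$; $a_{ij}=-1$ if $|i-j|=1$ and $1\le i,j\le n-1$; $a_{01}=-1$, $a_{10}=-2$, $a_{n-1,n}=-1$, $a_{n,n-1}=-2$; other entries $0$; $(d_i)_{i\in I}=(2,1,\dots,1,\frac12)$, $q_i=q^{d_i}$, $p(n)=1$, $p(i)=0$ for $i\ne n$. $[m]_i=\frac{((-1)^{p(i)}q_i)^m-q_i^{-m}}{(-1)^{p(i)}q_i-q_i^{-1}}$, $[m]_i!=[m]_i\cdots[1]_i$, $e_i^{(m)}=e_i^m/[m]_i!$, $f_i^{(m)}=f_i^m/[m]_i!$. $U_q(B^{(1)}(0,n))$ is the $\mathbb Q(q^{1/2})$-algebra generated by $e_i,f_i,k_i^{\pm1}$ ($i\in I$) with relations: $k_i$ commute and are invertible; $k_ie_jk_i^{-1}=q_i^{a_{ij}}e_j$; $k_if_jk_i^{-1}=q_i^{-a_{ij}}f_j$; $e_if_j-(-1)^{p(i)p(j)}f_je_i=\delta_{ij}\frac{k_i-k_i^{-1}}{q_i-q_i^{-1}}$;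 and for $i\neq j$, $\sum_{m=0}^{1-a_{ij}}(-1)^{m+p(i)m(m-1)/2+mp(i)p(j)}e_i^{(1-a_{ij}-m)}e_je_i^{(m)}=0$ and the same with $f$ in place of $e$. $U_q(B^{(1)}(0,n))^\sigma$ is generated by $U_q(B^{(1)}(0,n))$ and $\sigma$ with $\sigma^2=1$, $\sigma k_i=k_i\sigma$, $\sigma e_i=(-1)^{p(i)}e_i\sigma$, $\sigma f_i=(-1)^{p(i)}f_i\sigma$. *)

(* Defs.v *)
From HB Require Import structures.
From mathcomp Require Import all_boot all_order all_algebra.
From mathcomp Require Import boolp.
From mathcomp Require Import monalg.

Set Implicit Arguments.
Unset Strict Implicit.
Unset Printing Implicit Defensive.

Import GRing.Theory.

Local Open Scope ring_scope.

Section PresentedAlgebra.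
Variables (K : fieldType) (G : choiceType).

Definition free_alg : Type := {malg K[{fmonom G}]}.

HB.instance Definition _ := GRing.Lalgebra.on free_alg.

Definition free_gen (g : G) : free_alg := << fmu g >>.

Variable rel : free_alg -> free_alg -> Prop.

Inductive rel_ideal : free_alg -> Prop :=
| rel_ideal_rel u v : rel u v -> rel_ideal (u - v)
| rel_ideal0 : rel_ideal 0
| rel_idealD u v : rel_ideal u -> rel_ideal v -> rel_ideal (u + v)
| rel_idealM a u b : rel_ideal u -> rel_ideal (a * u * b).

Lemma rel_idealN u : rel_ideal u -> rel_ideal (- u).
Proof. by move/(rel_idealM (-1) 1); rewrite mulr1 mulN1r. Qed.

Lemma rel_idealZ (c : K) u : rel_ideal u -> rel_ideal (c *: u).
Proof. by move/(rel_idealM (c%:A) 1); rewrite mulr1 -scalerAl mul1r. Qed.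

Definition rel_equiv (u v : free_alg) : bool := `[< rel_ideal (u - v) >].

Lemma rel_equiv_refl : reflexive rel_equiv.
Proof. by move=> u; apply/asboolP; rewrite subrr; exact: rel_ideal0. Qed.

Lemma rel_equiv_sym : symmetric rel_equiv.
Proof.
by move=> u v; apply/asboolP/asboolP => /rel_idealN; rewrite opprB.
Qed.

Lemma rel_equiv_trans : transitive rel_equiv.
Proof.
move=> v u w /asboolP uv /asboolP vw; apply/asboolP.
by rewrite -(subrK v u) -addrA; exact: rel_idealD.
Qed.

Canonical rel_equiv_rel :=
  EquivRel rel_equiv rel_equiv_refl rel_equiv_sym rel_equiv_trans.

(* The ring and vector space structures on the quotient do not assert
   1 != 0, so [presented_alg] is a [pzRingType] and an [lmodType K] but not an
   [algType K]. *)
Definition presented_alg : Type := {eq_quot rel_equiv}%qT.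

HB.instance Definition _ := EqQuotient.on presented_alg.
HB.instance Definition _ := Choice.on presented_alg.

Definition palg_pi (u : free_alg) : presented_alg :=
  (\pi_({eq_quot rel_equiv}%qT) u)%qT.
Definition palg_repr (u : presented_alg) : free_alg :=
  repr (u : {eq_quot rel_equiv}%qT).

Lemma palg_reprK : cancel palg_repr palg_pi.
Proof. exact: reprK. Qed.

Lemma palg_piP u v : palg_pi u = palg_pi v <-> rel_ideal (u - v).
Proof.
by split=> [/eqmodP/asboolP//|uv]; apply/eqmodP/asboolP.
Qed.

Lemma palg_repr_pi u : rel_ideal (palg_repr (palg_pi u) - u).
Proof. by apply/palg_piP; exact: palg_reprK. Qed.

Definition palg_zero := palg_pi 0.
Definition palg_one := palg_pi 1.
Definition palg_add u v := palg_pi (palg_repr u + palg_repr v).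
Definition palg_opp u := palg_pi (- palg_repr u).
Definition palg_mul u v := palg_pi (palg_repr u * palg_repr v).
Definition palg_scale (c : K) u := palg_pi (c *: palg_repr u).

Lemma palg_addE u v : palg_add (palg_pi u) (palg_pi v) = palg_pi (u + v).
Proof.
apply/palg_piP; rewrite opprD addrACA.
exact: rel_idealD (palg_repr_pi u) (palg_repr_pi v).
Qed.

Lemma palg_oppE u : palg_opp (palg_pi u) = palg_pi (- u).
Proof. by apply/palg_piP; rewrite -opprD; exact/rel_idealN/palg_repr_pi. Qed.

Lemma palg_mulE u v : palg_mul (palg_pi u) (palg_pi v) = palg_pi (u * v).
Proof.
apply/palg_piP; set u' := palg_repr _; set v' := palg_repr _.
have -> : u' * v' - u * v = 1 * (u' - u) * v' + u * (v' - v) * 1.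
  by rewrite mul1r mulr1 mulrBl mulrBr addrA subrK.
by apply: rel_idealD; apply: rel_idealM; exact: palg_repr_pi.
Qed.

Lemma palg_scaleE c u : palg_scale c (palg_pi u) = palg_pi (c *: u).
Proof. by apply/palg_piP; rewrite -scalerBr; exact/rel_idealZ/palg_repr_pi. Qed.

Lemma palg_addA : associative palg_add.
Proof.
move=> u v w; rewrite -[u]palg_reprK -[v]palg_reprK -[w]palg_reprK.
by rewrite !palg_addE addrA.
Qed.

Lemma palg_addC : commutative palg_add.
Proof. by move=> u v; rewrite /palg_add addrC. Qed.

Lemma palg_add0 : left_id palg_zero palg_add.
Proof. by move=> u; rewrite -[u]palg_reprK palg_addE add0r. Qed.

Lemma palg_addN : left_inverse palg_zero palg_opp palg_add.
Proof. by move=> u; rewrite -[u]palg_reprK palg_oppE palg_addE addNr. Qed.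

HB.instance Definition _ := GRing.isZmodule.Build presented_alg
  palg_addA palg_addC palg_add0 palg_addN.

Lemma palg_mulA : associative palg_mul.
Proof.
move=> u v w; rewrite -[u]palg_reprK -[v]palg_reprK -[w]palg_reprK.
by rewrite !palg_mulE mulrA.
Qed.

Lemma palg_mul1l : left_id palg_one palg_mul.
Proof. by move=> u; rewrite -[u]palg_reprK palg_mulE mul1r. Qed.

Lemma palg_mul1r : right_id palg_one palg_mul.
Proof. by move=> u; rewrite -[u]palg_reprK palg_mulE mulr1. Qed.

Lemma palg_mulDl : left_distributive palg_mul palg_add.
Proof.
move=> u v w; rewrite -[u]palg_reprK -[v]palg_reprK -[w]palg_reprK.
by rewrite !(palg_addE, palg_mulE) mulrDl.
Qed.

Lemma palg_mulDr : right_distributive palg_mul palg_add.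
Proof.
move=> u v w; rewrite -[u]palg_reprK -[v]palg_reprK -[w]palg_reprK.
by rewrite !(palg_addE, palg_mulE) mulrDr.
Qed.

HB.instance Definition _ := GRing.Zmodule_isPzRing.Build presented_alg
  palg_mulA palg_mul1l palg_mul1r palg_mulDl palg_mulDr.

Lemma palg_scaleA a b u :
  palg_scale a (palg_scale b u) = palg_scale (a * b) u.
Proof. by rewrite -[u]palg_reprK !palg_scaleE scalerA. Qed.

Lemma palg_scale1 : left_id 1 palg_scale.
Proof. by move=> u; rewrite -[u]palg_reprK palg_scaleE scale1r. Qed.

Lemma palg_scaleDr : right_distributive palg_scale palg_add.
Proof.
move=> a u v; rewrite -[u]palg_reprK -[v]palg_reprK.
by rewrite !(palg_addE, palg_scaleE) scalerDr.
Qed.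

Lemma palg_scaleDl u :
  {morph (fun a => palg_scale a u) : a b / a + b >-> palg_add a b}.
Proof.
by move=> a b; rewrite -[u]palg_reprK !(palg_addE, palg_scaleE) scalerDl.
Qed.

HB.instance Definition _ := GRing.Zmodule_isLmodule.Build K presented_alg
  palg_scaleA palg_scale1 palg_scaleDr palg_scaleDl.

Definition palg_gen (g : G) : presented_alg := palg_pi (free_gen g).

Record is_module (V : lmodType K) (act : presented_alg -> V -> V) : Prop :=
  IsModule {
    module_act1 : forall v, act 1 v = v;
    module_actM : forall a b v, act (a * b) v = act a (act b v);
    module_act_linear_l : forall c a b v, act (c *: a + b) v = c *: act a v + act b v;
    module_act_linear_r : forall a c v w, act a (c *: v + w) = c *: act a v + act a w
  }.

Record is_submodule (V : lmodType K) (act : presented_alg -> V -> V)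
    (P : V -> Prop) : Prop := IsSubmodule {
  submodule0 : P 0;
  submodule_linear : forall (c : K) v w, P v -> P w -> P (c *: v + w);
  submodule_act : forall a v, P v -> P (act a v)
}.

Definition irreducible_module (V : lmodType K)
    (act : presented_alg -> V -> V) : Prop :=
  (exists v : V, v <> 0) /\
  forall P : V -> Prop, is_submodule act P ->
    (forall v, P v -> v = 0) \/ (forall v, P v).

End PresentedAlgebra.

Section Generators.
Variable n : nat.

Variant Ugen :=
| GenE of 'I_n.+1
| GenF of 'I_n.+1
| GenK of 'I_n.+1
| GenKinv of 'I_n.+1
| GenSigma.

Definition Ugen_encode (g : Ugen) : option ('I_4 * 'I_n.+1) :=
  match g with
  | GenE i => Some (inord 0, i)
  | GenF i => Some (inord 1, i)
  | GenK i => Some (inord 2, i)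
  | GenKinv i => Some (inord 3, i)
  | GenSigma => None
  end.

Definition Ugen_decode (c : option ('I_4 * 'I_n.+1)) : Ugen :=
  if c is Some (t, i) then
    match nat_of_ord t with
    | 0 => GenE i
    | 1 => GenF i
    | 2 => GenK i
    | _ => GenKinv i
    end
  else GenSigma.

Lemma Ugen_encodeK : cancel Ugen_encode Ugen_decode.
Proof. by case=> [i|i|i|i|] //=; rewrite inordK. Qed.

HB.instance Definition _ := Countable.copy Ugen (can_type Ugen_encodeK).

End Generators.

Arguments GenSigma {n}.

(* Throughout, [s] stands for q^(1/2). *)
Section QuantumSuperalgebra.
Variables (K : fieldType) (s : K) (n : nat).

Definition qpar : K := s ^+ 2.

Definition qint (m : int) : K :=
  (qpar ^ m - qpar ^ (- m)) / (qpar - qpar^-1).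

Definition cartan (i j : nat) : int :=
  if i == j then 2
  else if (i == 0)%N && (j == 1)%N then -1
  else if (i == 1)%N && (j == 0)%N then -2
  else if (i == n.-1) && (j == n) then -1
  else if (i == n) && (j == n.-1) then -2
  else if (i == j.+1) || (j == i.+1) then -1
  else 0.

Definition parity (i : nat) : nat := i == n.

(* 2 d_i, so that q_i = q^(d_i) = s^(2 d_i) *)
Definition twice_d (i : nat) : nat :=
  if i == 0%N then 4 else if i == n then 1 else 2.

Definition qi (i : nat) : K := s ^+ twice_d i.

Definition qint_i (i m : nat) : K :=
  (((-1) ^+ parity i * qi i) ^+ m - (qi i) ^- m) /
  ((-1) ^+ parity i * qi i - (qi i)^-1).

Definition qfact_i (i m : nat) : K := \prod_(1 <= l < m.+1) qint_i i l.

Definition UF : Type := free_alg K (Ugen n).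
HB.instance Definition _ := GRing.Lalgebra.on UF.

Let e (i : 'I_n.+1) : UF := free_gen K (GenE i).
Let f (i : 'I_n.+1) : UF := free_gen K (GenF i).
Let k (i : 'I_n.+1) : UF := free_gen K (GenK i).
Let k' (i : 'I_n.+1) : UF := free_gen K (GenKinv i).
Let sigma : UF := free_gen K GenSigma.

Definition divpow (i : nat) (u : UF) (m : nat) : UF :=
  (qfact_i i m)^-1 *: u ^+ m.

(* 1 - a_ij, a natural number for i <> j *)
Definition serre_deg (i j : nat) : nat := `|1 - cartan i j|%N.

Definition serre (i j : nat) (u v : UF) : UF :=
  \sum_(m < (serre_deg i j).+1)
    (-1) ^+ (m + parity i * (m * m.-1)./2 + m * parity i * parity j)%N *:
      (divpow i u (serre_deg i j - m) * v * divpow i u m).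

Variant Usigma_rel : UF -> UF -> Prop :=
| rel_kk (i j : 'I_n.+1) : Usigma_rel (k i * k j) (k j * k i)
| rel_kk' (i : 'I_n.+1) : Usigma_rel (k i * k' i) 1
| rel_k'k (i : 'I_n.+1) : Usigma_rel (k' i * k i) 1
| rel_ke (i j : 'I_n.+1) :
    Usigma_rel (k i * e j * k' i) (qi i ^ cartan i j *: e j)
| rel_kf (i j : 'I_n.+1) :
    Usigma_rel (k i * f j * k' i) (qi i ^ (- cartan i j) *: f j)
| rel_ef (i j : 'I_n.+1) :
    Usigma_rel (e i * f j - (-1) ^+ (parity i * parity j)%N *: (f j * e i))
      (if i == j then (qi i - (qi i)^-1)^-1 *: (k i - k' i) else 0)
| rel_serre_e (i j : 'I_n.+1) : i != j -> Usigma_rel (serre i j (e i) (e j)) 0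
| rel_serre_f (i j : 'I_n.+1) : i != j -> Usigma_rel (serre i j (f i) (f j)) 0
| rel_sigma2 : Usigma_rel (sigma * sigma) 1
| rel_sigma_k (i : 'I_n.+1) : Usigma_rel (sigma * k i) (k i * sigma)
| rel_sigma_e (i : 'I_n.+1) :
    Usigma_rel (sigma * e i) ((-1) ^+ parity i *: (e i * sigma))
| rel_sigma_f (i : 'I_n.+1) :
    Usigma_rel (sigma * f i) ((-1) ^+ parity i *: (f i * sigma)).

(* U_q(B^(1)(0,n))^sigma, presented directly by the generators and relations
   of U_q(B^(1)(0,n)) together with those involving sigma. *)
Definition Usigma : Type := presented_alg Usigma_rel.

End QuantumSuperalgebra.

Section FockSpace.
Variables (K : fieldType) (s : K) (n : nat).

Definition Fock : Type := {malg K[{ffun 'I_n -> nat}]}.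
HB.instance Definition _ := GRing.Lmodule.on Fock.

(* Multi-indices with possibly negative entries; they are numbered from 1, so
   that position j is stored at the ordinal j - 1. *)
Definition zvec : Type := {ffun 'I_n -> int}.
HB.instance Definition _ := GRing.Zmodule.on zvec.

Definition entry (m : zvec) (j : nat) : int := oapp m 0 (insub j.-1).
Definition std (j : nat) : zvec := [ffun i : 'I_n => (i.+1 == j)%:Z].
Definition zvec_nonneg (m : zvec) : bool := [forall i, 0 <= m i].
Definition zvec_size (m : zvec) : int := \sum_(i < n) m i.

(* |m>, which is 0 as soon as m has a negative entry *)
Definition ket (m : zvec) : Fock :=
  if zvec_nonneg m then << [ffun i : 'I_n => `|m i|%N] >> else 0.

Local Notation q := (qpar s).
Local Notation "[ m ]_q" := (qint s m) (format "[ m ]_q").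
Local Notation gen g := (palg_gen (Usigma_rel s (n:=n)) g).

Record Fock_formulas (x : K) (act : Usigma s n -> Fock -> Fock) : Prop :=
  FockFormulas {
    act_e0 : forall m, zvec_nonneg m ->
      act (gen (GenE (inord 0))) (ket m) =
      (x * q^-1 * ([entry m 1 + 1]_q * [entry m 1 + 2]_q / [2]_q)) *:
        ket (m + std 1 *+ 2);
    act_f0 : forall m, zvec_nonneg m ->
      act (gen (GenF (inord 0))) (ket m) =
      (- x^-1 * (q / [2]_q)) *: ket (m - std 1 *+ 2);
    act_k0 : forall m, zvec_nonneg m ->
      act (gen (GenK (inord 0))) (ket m) = q ^ (2 * entry m 1 + 1) *: ket m;
    act_ej : forall m j, zvec_nonneg m -> (1 <= j <= n.-1)%N ->
      act (gen (GenE (inord j))) (ket m) =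
      [entry m j.+1 + 1]_q *: ket (m - std j + std j.+1);
    act_fj : forall m j, zvec_nonneg m -> (1 <= j <= n.-1)%N ->
      act (gen (GenF (inord j))) (ket m) =
      [entry m j + 1]_q *: ket (m + std j - std j.+1);
    act_kj : forall m j, zvec_nonneg m -> (1 <= j <= n.-1)%N ->
      act (gen (GenK (inord j))) (ket m) =
      q ^ (- entry m j + entry m j.+1) *: ket m;
    act_en : forall m, zvec_nonneg m ->
      act (gen (GenE (inord n))) (ket m) = - s *: ket (m - std n);
    act_fn : forall m, zvec_nonneg m ->
      act (gen (GenF (inord n))) (ket m) =
      (s^-1 * [entry m n + 1]_q) *: ket (m + std n);
    act_kn : forall m, zvec_nonneg m ->
      act (gen (GenK (inord n))) (ket m) =
      (q ^ (- entry m n) * s^-1) *: ket m;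
    act_sigma : forall m, zvec_nonneg m ->
      act (gen GenSigma) (ket m) = (-1) ^ zvec_size m *: ket m
  }.

End FockSpace.

(* Q(q^(1/2)), realised as the rational functions over Q whose variable is
   q^(1/2) *)
Definition Qqh : Type := {fraction {poly rat}}.
HB.instance Definition _ := GRing.Field.on Qqh.

Definition qhalf : Qqh := tofrac 'X.

(* Main.v *)
Require Import Defs.
From HB Require Import structures.
From mathcomp Require Import all_boot all_order all_algebra.
From mathcomp Require Import boolp finmap monalg zify ring.

Set Implicit Arguments.
Unset Strict Implicit.
Unset Printing Implicit Defensive.

Import Order.TTheory GRing.Theory Num.Theory.
Local Open Scope ring_scope.

(** Every generator sends a basis vector to a multiple of another one: [g |m>
    = c_g(m) |m + d_g>], with [d_g = alpha_i, - alpha_i, 0, 0] for [e_i, f_i,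
    k_i, sigma], where [alpha_0 = 2 e_1] and [alpha_i = e_{i+1} - e_i] (with
    [e_{n+1} = 0]). The coefficient [c_g(m)] makes sense for every [m] in
    [Z^n], and it vanishes whenever [m] has a negative entry but [m + d_g]
    does not ([gen_coef_boundary]). Hence the formula holds on all of [Z^n],
    with [|m> = 0] outside the nonnegative orthant, and a product of
    generators is again such a weighted shift, whose coefficient is a product
    of shifted coefficients with no boundary case.

    A defining relation only compares products of the same total shift, so it
    amounts to one scalar identity between products of quantum integers; in
    the variables [q^{m_1}, ..., q^{m_n}] and [q] this is an identity of
    rational functions. For instance the Serre relations say, up to common
    factors, that [a -> [a + 1]] or [a -> [a + 1][a + 2]], being a combination
    of [q^a, q^{-a}] or of [q^{2a}, 1, q^{-2a}], is killed by a difference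
    operator in [a] with these solutions. The identities are [ef_comm],
    [ef_diag], [kcoef_alpha], [serre_coef_e] and [serre_coef_f], and
    [Usigma_rel_act] collects them. The generators therefore act through the
    presented algebra; the action is unique because kets span, and because
    [k_i^{-1}] is forced by [k_i].

    Irreducibility: the eigenvalues of the [k_i] on [|m>] determine [m]
    ([kcoef_inj]), because [q] is not a root of unity. Subtracting eigenvalues
    thus shrinks the support of a nonzero vector of a submodule until a single
    ket is left ([submod_has_ket]). For [1 <= p <= n] the operator [e_p] moves
    a particle from position [p] to position [p + 1] (or out, when [p = n])
    and [f_p] moves it back, both with nonzero coefficients; so every ket is
    linked with [|0>] ([submod_ket]) and the submodule is everything.

    All this holds over a field in which [s = q^{1/2}] is nonzero and not a
    root of unity; the indeterminate of the rational functions is such an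
    element. *)

(** * Linear extension from a basis *)

Section LinearExtension.
Variables (K : fieldType) (M : choiceType).

Lemma malg_linear_ind (P : {malg K[M]} -> Prop) :
  P 0 -> (forall c u v, P u -> P v -> P (c *: u + v)) ->
  (forall m, P << m >>) -> forall u, P u.
Proof.
move=> P0 PD PU u; rewrite (monalgE u).
elim: (enum_fset _) => [|m l IH]; first by rewrite big_nil.
rewrite big_cons; suff -> : << u@_m *g m >> = u@_m *: << m >> by exact: PD.
by apply/malgP => k; rewrite mcoeffZ !mcoeffU mulr_natr.
Qed.

Variables (V : lmodType K) (F : M -> V).

Definition linext (u : {malg K[M]}) : V :=
  \sum_(m <- msupp u) u@_m *: F m.

Lemma linextEw (d : {fset M}) (u : {malg K[M]}) :
  (msupp u `<=` d)%fset -> linext u = \sum_(m <- d) u@_m *: F m.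
Proof.
move=> le; apply: big_fset_incl => // m _ /mcoeff_outdom ->.
by rewrite scale0r.
Qed.

Lemma linext_is_linear : linear linext.
Proof.
move=> c u v; set d := (msupp u `|` msupp v)%fset.
have led : (msupp (c *: u + v) `<=` d)%fset.
  apply: fsubset_trans (msuppD_le _ _) _.
  by apply: fsetUSS (msuppZ_le _ _) _.
rewrite (linextEw led) (linextEw (fsubsetUl (msupp u) (msupp v))).
rewrite (linextEw (fsubsetUr (msupp u) (msupp v))) scaler_sumr -big_split /=.
by apply: eq_bigr => m _; rewrite mcoeffD mcoeffZ scalerDl scalerA.
Qed.

HB.instance Definition _ :=
  GRing.isLinear.Build K {malg K[M]} V *:%R linext linext_is_linear.

Lemma linextU m : linext << m >> = F m.
Proof.
by rewrite (linextEw msuppU_le) big_seq_fset1 mcoeffUU scale1r.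
Qed.

End LinearExtension.

(** * Modules over algebras given by generators and relations *)

Section MonoidAlgebra.
Variables (K : fieldType) (M : monomType).

Lemma malgU1M (m m' : M) :
  (<< m >> : {malg K[M]}) * << m' >> = << mmul m m' >>.
Proof. by rewrite malgM_def fgmulUU mulr1. Qed.

(** Scalars are central in the monoid algebra because [K] is commutative. *)
Lemma malg_scalerAr c (m : M) (b : {malg K[M]}) :
  (<< m >> : {malg K[M]}) * (c *: b) = c *: (<< m >> * b).
Proof.
rewrite -!mul_malgC !mulrA; congr (_ * b).
by rewrite !malgM_def !fgmulUU mulr1 mul1r mulm1 mul1m.
Qed.

End MonoidAlgebra.

Section FreeAction.
Variables (K : fieldType) (G : choiceType) (V : lmodType K).

Lemma free_alg_linear_ind (P : free_alg K G -> Prop) :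
  P 0 -> (forall c u v, P u -> P v -> P (c *: u + v)) ->
  (forall m, P << m >>) -> forall u, P u.
Proof. exact: malg_linear_ind. Qed.

Variable T : G -> {linear V -> V}.

Definition word_act (w : {fmonom G}) (v : V) : V :=
  foldr (fun g => T g) v w.

Definition free_act (u : free_alg K G) (v : V) : V :=
  linext (fun w => word_act w v) u.

Lemma free_act_linear_l c (a b : free_alg K G) v :
  free_act (c *: a + b) v = c *: free_act a v + free_act b v.
Proof. exact: linearP. Qed.

Lemma free_act0l v : free_act 0 v = 0.
Proof. exact: linear0. Qed.

Lemma free_actDl a b v : free_act (a + b) v = free_act a v + free_act b v.
Proof. by rewrite -[a]scale1r free_act_linear_l !scale1r. Qed.

Lemma free_actZl c a v : free_act (c *: a) v = c *: free_act a v.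
Proof. by rewrite -[c *: a]addr0 free_act_linear_l free_act0l addr0. Qed.

Lemma free_actBl a b v : free_act (a - b) v = free_act a v - free_act b v.
Proof. by rewrite free_actDl -(scaleN1r b) free_actZl scaleN1r. Qed.

Lemma free_act_word w v : free_act << w >> v = word_act w v.
Proof. exact: linextU. Qed.

Lemma free_act_gen g v : free_act (free_gen K g) v = T g v.
Proof. by rewrite free_act_word /word_act fmU. Qed.

Lemma free_act1 v : free_act 1 v = v.
Proof. by rewrite free_act_word /word_act fm1. Qed.

Lemma free_act_linear_r (a : free_alg K G) c v w :
  free_act a (c *: v + w) = c *: free_act a v + free_act a w.
Proof.
elim/free_alg_linear_ind: a => [|d a b IHa IHb|m].
- by rewrite !free_act0l scaler0 addr0.
- rewrite !free_act_linear_l IHa IHb !scalerDr !scalerA mulrC -!addrA.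
  by congr (_ + _); rewrite addrCA.
rewrite !free_act_word /word_act; elim: (m : seq G) => //= g l ->.
exact: linearP.
Qed.

Lemma free_act0r a : free_act a 0 = 0.
Proof.
by have := free_act_linear_r a (-1) 0 0; rewrite scaler0 addr0 scaleN1r addNr.
Qed.

Lemma free_actM a b v : free_act (a * b) v = free_act a (free_act b v).
Proof.
elim/free_alg_linear_ind: a => [|d a a' IHa IHa'|m].
- by rewrite mul0r !free_act0l.
- rewrite (mulrDl (d *: a)) -scalerAl !free_act_linear_l.
  by congr (_ *: _ + _); [exact: IHa | exact: IHa'].
elim/free_alg_linear_ind: b => [|d b b' IHb IHb'|m'].
- by rewrite mulr0 !free_act0l free_act0r.
- rewrite mulrDr malg_scalerAr !free_act_linear_l free_act_linear_r.
  by congr (_ *: _ + _); [exact: IHb | exact: IHb'].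
rewrite malgU1M !free_act_word /word_act fmM; exact: foldr_cat.
Qed.

End FreeAction.

Section PresentedModule.
Variables (K : fieldType) (G : choiceType) (V : lmodType K).
Variable rel : free_alg K G -> free_alg K G -> Prop.
Implicit Types (act : presented_alg rel -> V -> V).

Lemma palg_pi_linear c a b :
  palg_pi rel (c *: a + b) = c *: palg_pi rel a + palg_pi rel b.
Proof. by rewrite -palg_addE -palg_scaleE. Qed.

Lemma palg_piM a b : palg_pi rel (a * b) = palg_pi rel a * palg_pi rel b.
Proof. by rewrite -palg_mulE. Qed.

(** Elements of the quotient act through a chosen representative; [palg_act_pi]
    below says that the choice is harmless when the relations hold. *)
Definition palg_act (T : G -> {linear V -> V}) (a : presented_alg rel) (v : V) :
  V := free_act T (palg_repr a) v.

Section FromGenerators.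
Variable T : G -> {linear V -> V}.
Hypothesis T_rel : forall u u', rel u u' ->
  forall v, free_act T u v = free_act T u' v.

Lemma palg_act_pi u v : palg_act T (palg_pi rel u) v = free_act T u v.
Proof.
apply/eqP; rewrite -subr_eq0 -free_actBl; apply/eqP.
elim: (palg_repr_pi rel u) v => {u}
  [u u' uu' v||u u' _ IH _ IH' v|a u b _ IH v].
- by rewrite free_actBl (T_rel uu') subrr.
- exact: free_act0l.
- by rewrite free_actDl IH IH' addr0.
- by rewrite !free_actM IH free_act0r.
Qed.

Lemma palg_act_gen g v : palg_act T (palg_gen rel g) v = T g v.
Proof. by rewrite palg_act_pi free_act_gen. Qed.

Lemma palg_act_is_module : is_module (palg_act T).
Proof.
split=> [v|a b v|c a b v|a c v w].
- by rewrite palg_act_pi free_act1.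
- rewrite -[a]palg_reprK -[b]palg_reprK -palg_piM !palg_act_pi.
  exact: free_actM.
- rewrite -[a]palg_reprK -[b]palg_reprK -palg_pi_linear !palg_act_pi.
  exact: free_act_linear_l.
- exact: free_act_linear_r.
Qed.

End FromGenerators.

(** The elements on which two module structures agree form a subalgebra. *)
Lemma module_ext act act' : is_module act -> is_module act' ->
  (forall g v, act (palg_gen rel g) v = act' (palg_gen rel g) v) ->
  forall a v, act a v = act' a v.
Proof.
move=> mod mod' eqg a; rewrite -[a]palg_reprK.
have act0 act1 : is_module act1 -> forall v, act1 0 v = 0.
  move=> m1 v; have := module_act_linear_l m1 (-1) 0 0 v.
  by rewrite scaler0 addr0 scaleN1r addNr.
elim/free_alg_linear_ind: (palg_repr a) => [v|c u v IHu IHv w|m v].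
- by rewrite (act0 _ mod) (act0 _ mod').
- rewrite palg_pi_linear (module_act_linear_l mod) (module_act_linear_l mod').
  by rewrite IHu IHv.
have -> : m = FMonom m by apply/eqP; rewrite fmP.
elim: (m : seq G) v => [|g l IH] v.
  have -> : palg_pi rel << FMonom [::] >> = 1 by rewrite -fmoneE.
  by rewrite (module_act1 mod) (module_act1 mod').
have -> : palg_pi rel << FMonom (g :: l) >> =
    palg_gen rel g * palg_pi rel << FMonom l >>.
  rewrite /palg_gen /free_gen -palg_piM malgU1M; congr (palg_pi _ << _ >>).
  by apply/eqP; rewrite fmP fmM fmU.
by rewrite (module_actM mod) (module_actM mod') IH eqg.
Qed.

Lemma module_act0 act a : is_module act -> act a 0 = 0.
Proof.
move=> mod; have := module_act_linear_r mod a (-1) 0 0.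
by rewrite scaler0 addr0 scaleN1r addNr.
Qed.

End PresentedModule.

(** * Multi-indices *)

Section Entries.
Variable n : nat.
Implicit Types m d : zvec n.

Lemma entryD m d p : entry (m + d) p = entry m p + entry d p.
Proof. by rewrite /entry; case: insub => [i|] //=; rewrite ?addr0 // ffunE. Qed.

Lemma entryN m p : entry (- m) p = - entry m p.
Proof. by rewrite /entry; case: insub => [i|] //=; rewrite ?oppr0 // ffunE. Qed.

Lemma entry_std j p : (0 < p)%N ->
  entry (std n j) p = ((j == p) && (p <= n)%N)%:Z.
Proof.
case: p => // p _; rewrite /entry /=; case: insubP => [i lt_pn ip|] /=.
  by rewrite ffunE ip lt_pn andbT eq_sym.
by move=> /negbTE ->; rewrite andbF.
Qed.

Lemma entryE m (i : 'I_n) : entry m i.+1 = m i.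
Proof. by rewrite /entry /= valK. Qed.

Lemma entry_nonneg m p : zvec_nonneg m -> 0 <= entry m p.
Proof. by move=> /forallP m0; rewrite /entry; case: insub. Qed.

Lemma nonnegP m :
  reflect (forall p, (0 < p <= n)%N -> 0 <= entry m p) (zvec_nonneg m).
Proof.
apply: (iffP idP) => [m0 p _|m0]; first exact: entry_nonneg.
by apply/forallP => i; rewrite -entryE m0 //= ltn_ord.
Qed.

Lemma neg_entry m :
  ~~ zvec_nonneg m -> exists2 p, (0 < p <= n)%N & entry m p < 0.
Proof.
move=> mneg; apply/not_exists2P => all_ge; case/negP: mneg.
by apply/nonnegP => p p1n; case: (all_ge p) => // /negP; rewrite -leNgt.
Qed.

Lemma zvec_sizeD m d :
  zvec_size (m + d) = zvec_size m + zvec_size d.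
Proof. by rewrite -big_split; apply: eq_bigr => i _; rewrite ffunE. Qed.

Lemma zvec_sizeN m : zvec_size (- m) = - zvec_size m.
Proof. by rewrite -sumrN; apply: eq_bigr => i _; rewrite ffunE. Qed.

Lemma zvec_size_std j : zvec_size (std n j) = (0 < j <= n)%:Z.
Proof.
case: j => [|j] /=.
  by rewrite /zvec_size big1 // => i _; rewrite ffunE.
rewrite /zvec_size; case: ltnP => [ltjn|lenj] /=.
  rewrite (bigD1 (Ordinal ltjn)) //= big1 ?ffunE ?eqxx ?addr0 // => i neq.
  by rewrite ffunE eqSS -[j]/(val (Ordinal ltjn)) val_eqE (negbTE neq).
by rewrite big1 // => i _; rewrite ffunE eqSS ltn_eqF // (leq_trans _ lenj).
Qed.

End Entries.

(** * Weighted shifts *)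

Section WeightedShifts.
Variables (K : fieldType) (n : nat).
Local Notation ket := (@ket K n).

Definition natvec (mm : {ffun 'I_n -> nat}) : zvec n := [ffun i => (mm i)%:Z].

Lemma natvec_nonneg mm : zvec_nonneg (natvec mm).
Proof. by apply/forallP => i; rewrite ffunE. Qed.

Lemma ket_natvec mm : ket (natvec mm) = << mm >>.
Proof.
rewrite /Defs.ket natvec_nonneg; congr << _ >>.
by apply/ffunP => i; rewrite !ffunE.
Qed.

Lemma nonneg_natvec (m : zvec n) :
  zvec_nonneg m -> m = natvec [ffun i => `|m i|%N].
Proof.
by move=> /forallP m0; apply/ffunP => i; rewrite !ffunE gez0_abs.
Qed.

Lemma ket_neg (m : zvec n) : ~~ zvec_nonneg m -> ket m = 0.
Proof. by rewrite /Defs.ket => /negbTE ->. Qed.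

Lemma Fock_linear_ind (P : Fock K n -> Prop) :
  P 0 -> (forall c u v, P u -> P v -> P (c *: u + v)) ->
  (forall m, zvec_nonneg m -> P (ket m)) -> forall u, P u.
Proof.
move=> P0 PD Pket; apply: malg_linear_ind => // mm.
by rewrite -ket_natvec; exact/Pket/natvec_nonneg.
Qed.

Definition wshift (c : zvec n -> K) (d : zvec n) : Fock K n -> Fock K n :=
  linext (fun mm => c (natvec mm) *: ket (natvec mm + d)).

HB.instance Definition _ c d := GRing.Linear.on (wshift c d).

(** The vanishing condition makes the formula valid for all [m], also when
    [|m> = 0]: this is what removes the boundary cases from every product of
    weighted shifts. *)
Lemma wshift_ket c d :
  (forall m, ~~ zvec_nonneg m -> zvec_nonneg (m + d) -> c m = 0) ->
  forall m, wshift c d (ket m) = c m *: ket (m + d).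
Proof.
move=> c0 m; have [m0|mneg] := boolP (zvec_nonneg m).
  by rewrite (nonneg_natvec m0) ket_natvec /wshift linextU.
rewrite (ket_neg mneg) linear0.
have [md0|mdneg] := boolP (zvec_nonneg (m + d)); first by rewrite c0 ?scale0r.
by rewrite ket_neg ?scaler0.
Qed.

End WeightedShifts.

Section UAction.
Variables (K : fieldType) (n : nat).
Local Notation ket := (@ket K n).
Variable T : Ugen n -> {linear Fock K n -> Fock K n}.

(** [free_act] on [UF], which carries its own copies of the operations of
    [free_alg]. *)
Definition Uact (u : UF K n) (v : Fock K n) : Fock K n := free_act T u v.

Lemma Uact0 v : Uact 0 v = 0.
Proof. exact: free_act0l. Qed.

Lemma Uact1 v : Uact 1 v = v.
Proof. exact: free_act1. Qed.

Lemma UactD a b v : Uact (a + b) v = Uact a v + Uact b v.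
Proof. exact: free_actDl. Qed.

Lemma UactB a b v : Uact (a - b) v = Uact a v - Uact b v.
Proof. exact: free_actBl. Qed.

Lemma UactZ c a v : Uact (c *: a) v = c *: Uact a v.
Proof. exact: free_actZl. Qed.

Lemma UactM a b v : Uact (a * b) v = Uact a (Uact b v).
Proof. exact: free_actM. Qed.

Lemma Uact_sum N (F : 'I_N -> UF K n) v :
  Uact (\sum_(k < N) F k) v = \sum_(k < N) Uact (F k) v.
Proof.
elim: N F => [|N IH] F; first by rewrite !big_ord0 Uact0.
by rewrite !big_ord_recr UactD IH.
Qed.

Lemma Uact0r a : Uact a 0 = 0.
Proof. exact: free_act0r. Qed.

Lemma UactP a c v w : Uact a (c *: v + w) = c *: Uact a v + Uact a w.
Proof. exact: free_act_linear_r. Qed.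

Lemma UactZr a c v : Uact a (c *: v) = c *: Uact a v.
Proof. by rewrite -[c *: v]addr0 UactP Uact0r addr0. Qed.

Lemma Uact_gen g v : Uact (free_gen K g) v = T g v.
Proof. exact: free_act_gen. Qed.

Lemma Uact_ext u u' :
  (forall m, zvec_nonneg m -> Uact u (ket m) = Uact u' (ket m)) ->
  forall v, Uact u v = Uact u' v.
Proof.
move=> eq_ket; apply: Fock_linear_ind => [|c v w IHv IHw|//].
  by rewrite !Uact0r.
by rewrite !UactP IHv IHw.
Qed.

Definition shifts (u : UF K n) (c : zvec n -> K) (d : zvec n) :=
  forall m, Uact u (ket m) = c m *: ket (m + d).

Lemma shiftsM u c d v c' d' : shifts u c d -> shifts v c' d' ->
  shifts (u * v) (fun m => c (m + d') * c' m) (d' + d).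
Proof. by move=> uE vE m; rewrite UactM vE UactZr uE scalerA mulrC addrA. Qed.

Lemma shiftsX u c d k : shifts u c d ->
  shifts (u ^+ k) (fun m => \prod_(l < k) c (m + d *+ l)) (d *+ k).
Proof.
move=> uE; elim: k => [|k IH] m.
  by rewrite expr0 Uact1 big_ord0 scale1r mulr0n addr0.
rewrite exprS UactM IH UactZr uE scalerA big_ord_recr /= mulrSr.
by rewrite -addrA.
Qed.

Lemma shiftsZ u c d a : shifts u c d -> shifts (a *: u) (fun m => a * c m) d.
Proof. by move=> uE m; rewrite UactZ uE scalerA. Qed.

End UAction.

(** * Serre elements acting by weighted shifts *)

Section SerreOnShifts.
Variables (K : fieldType) (s : K) (n : nat).
Local Notation ket := (@ket K n).
Variable T : Ugen n -> {linear Fock K n -> Fock K n}.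
Variables (u v : UF K n) (c c' : zvec n -> K) (d d' : zvec n).
Hypothesis uE : shifts T u c d.
Hypothesis vE : shifts T v c' d'.
Variables i j : nat.
Let N := serre_deg n i j.

(** In the summand of index [k] the operator [u] is applied [k] times, then [v]
    once, then [u] again [N - k] times. *)
Definition serre_coef m : K :=
  \sum_(k < N.+1) (-1) ^+ (k + parity n i * (k * k.-1)./2 +
                           k * parity n i * parity n j)%N *
    ((qfact_i s n i (N - k))^-1 *
       (\prod_(l < N - k) c (m + d *+ k + d' + d *+ l)) *
     c' (m + d *+ k) *
     ((qfact_i s n i k)^-1 * \prod_(l < k) c (m + d *+ l))).

Lemma serre_shifts : shifts T (serre s i j u v) serre_coef (d *+ N + d').
Proof.
move=> m; rewrite /serre -/N Uact_sum /serre_coef scaler_suml.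
apply: eq_bigr => k _; rewrite UactZ -scalerA; congr (_ *: _).
have [uX uX'] := (shiftsX (N - k) uE, shiftsX k uE).
rewrite (shiftsM (shiftsM (shiftsZ _ uX) vE) (shiftsZ _ uX')).
congr (_ *: ket (_ + _)).
have -> : d *+ N = d *+ k + d *+ (N - k) by rewrite -mulrnDr subnKC // -ltnS.
by rewrite !addrA addrAC.
Qed.

Hypothesis pij : (parity n i * parity n j = 0)%N.
Let eps : K := (-1) ^+ parity n i.
Let b := qint_i s n i.
Hypothesis b1 : b 1 = 1.
Hypothesis b2 : b 2 != 0.
Hypothesis b3 : b 3 != 0.

Let sign k :
  (-1) ^+ (k + parity n i * (k * k.-1)./2 + k * parity n i * parity n j) =
  (-1) ^+ k * eps ^+ (k * k.-1)./2 :> K.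
Proof. by rewrite -mulnA pij muln0 addn0 exprD exprM. Qed.

Let qf0 : qfact_i s n i 0 = 1.
Proof. by rewrite /qfact_i big_nil. Qed.

Let qf1 : qfact_i s n i 1 = 1.
Proof. by rewrite /qfact_i big_nat1. Qed.

Let qf2 : qfact_i s n i 2 = b 2.
Proof. by rewrite /qfact_i big_nat_recr //= big_nat1 -/b b1 mul1r. Qed.

Let qf3 : qfact_i s n i 3 = b 2 * b 3.
Proof. by rewrite /qfact_i big_nat_recr //= -/(qfact_i s n i 2) qf2. Qed.

(** The three lengths that occur in the Serre relations.  The hypotheses are the
    relations multiplied by the quantum factorial of [N], with
    [eps = (-1)^{p(i)}]; the three-term one has no binomial other than [b 2],
    and in the four-term one both inner binomials equal [b 3]. *)
Lemma serre_coef1 m : N = 1%N ->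
  c (m + d') * c' m = c' (m + d) * c m -> serre_coef m = 0.
Proof.
move=> deg cc; rewrite /serre_coef deg !big_ord_recl big_ord0 /= /bump /=.
rewrite !subn0 !subnn !(sign, qf0, qf1) /=.
rewrite !(big_ord_recl, big_ord0) /= /bump /=.
rewrite !(mulr0n, mulr1n, addr0) -[RHS](subrr (c (m + d') * c' m)) {2}cc.
by rewrite !invr1; ring.
Qed.

Lemma serre_coef2 m : N = 2 ->
  c (m + d') * c (m + d' + d) * c' m - b 2 * (c (m + d + d') * c' (m + d) * c m)
  + eps * (c' (m + d + d) * (c m * c (m + d))) = 0 -> serre_coef m = 0.
Proof.
move=> deg cc; rewrite /serre_coef deg !big_ord_recl big_ord0 /= /bump /=.
rewrite !subn0 !subnn !(sign, qf0, qf1, qf2) /=.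
rewrite !(big_ord_recl, big_ord0) /= /bump /=.
rewrite !(mulr0n, mulr1n, addr0, mulr2n, addrA).
apply: (mulfI b2); rewrite mulr0 -[RHS]cc invr1.
by field.
Qed.

Lemma serre_coef3 m : N = 3 ->
  c (m + d') * c (m + d' + d) * c (m + d' + d + d) * c' m
  - b 3 * (c (m + d + d') * c (m + d + d' + d) * c' (m + d) * c m)
  + eps * b 3 * (c (m + d + d + d') * c' (m + d + d) * (c m * c (m + d)))
  - eps * (c' (m + d + d + d) * (c m * c (m + d) * c (m + d + d))) = 0 ->
  serre_coef m = 0.
Proof.
move=> deg cc; rewrite /serre_coef deg !big_ord_recl big_ord0 /= /bump /=.
rewrite !subn0 !subnn !(sign, qf0, qf1, qf2, qf3) /=.
rewrite !(big_ord_recl, big_ord0) /= /bump /=.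
rewrite !(mulr0n, mulr1n, addr0, mulrS, addrA).
have eps3 : eps ^+ 3 = eps.
  rewrite /eps /parity; case: (_ == _); rewrite ?expr1n //.
  by rewrite exprS sqrrN expr1n mulr1.
apply: (mulfI (mulf_neq0 b2 b3)); rewrite mulr0 -[RHS]cc invr1 eps3.
by field; rewrite b2 b3.
Qed.

End SerreOnShifts.

(** * Quantum integers at a parameter of infinite order *)

Section QNumbers.
Variables (K : fieldType) (s : K).
Hypothesis s_neq0 : s != 0.
Hypothesis s_inf : forall k, (0 < k)%N -> s ^+ k != 1.
Local Notation q := (qpar s).

Lemma qpar_neq0 : q != 0.
Proof. by rewrite expf_neq0. Qed.

Lemma sexpz_eq1 (z : int) : s ^ z = 1 -> z = 0.
Proof.
case: z => [[|k]|k] // /eqP; first by rewrite -exprnP (negbTE (s_inf _)).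
by rewrite NegzE -exprnN invr_eq1 (negbTE (s_inf _)).
Qed.

Lemma qexpz (a : int) : q ^ a = s ^ (2 * a).
Proof. by rewrite /qpar exprnP exprz_exp. Qed.

Lemma qexpz_inj (a b : int) : q ^ a = q ^ b -> a = b.
Proof.
move=> eab; have : s ^ (2 * (a - b)) = 1.
  rewrite -qexpz expfzDr ?qpar_neq0 // -invr_expz eab mulfV //.
  by rewrite expfz_neq0 ?qpar_neq0.
by move/sexpz_eq1; lia.
Qed.

Lemma qpar_subV_neq0 : q - q^-1 != 0.
Proof.
rewrite subr_eq0; apply/eqP => e.
by have := @qexpz_inj 1 (-1); rewrite expr1z exprN1 => /(_ e).
Qed.

Lemma qint_eq0 (a : int) : (qint s a == 0) = (a == 0).
Proof.
rewrite /qint mulf_eq0 invr_eq0 (negbTE qpar_subV_neq0) orbF subr_eq0.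
by apply/eqP/eqP => [/qexpz_inj|->]; [lia|rewrite oppr0].
Qed.

Lemma qpar_addV_neq0 : q + q^-1 != 0.
Proof.
have := qint_eq0 2; rewrite /qint.
have -> : q ^ 2 - q ^ (-2) = (q + q^-1) * (q - q^-1).
  by rewrite -exprnN -exprnP; field; exact: qpar_neq0.
by rewrite mulfK ?qpar_subV_neq0 // => ->.
Qed.

Lemma qint2 : qint s 2 = q + q^-1.
Proof.
rewrite /qint; apply/(mulIf qpar_subV_neq0); rewrite mulfVK ?qpar_subV_neq0 //.
by rewrite -exprnN -exprnP; field; exact: qpar_neq0.
Qed.

Variable n : nat.

Lemma twice_d_gt0 i : (0 < twice_d n i)%N.
Proof. by rewrite /twice_d; case: ifP => //; case: ifP. Qed.

Lemma qi_neq0 i : qi s n i != 0.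
Proof. by rewrite expf_neq0. Qed.

(** If the numerator of [[m]_i] vanished, then squaring [(+-1) q_i^{2m} = 1]
    would make a positive power of [s] equal to [1]. *)
Lemma qint_i_num_neq0 i m : (0 < m)%N ->
  ((-1) ^+ parity n i * qi s n i) ^+ m - qi s n i ^- m != 0.
Proof.
move=> m0; rewrite subr_eq0; apply/eqP => e.
have Q0 : qi s n i ^+ m != 0 by rewrite expf_neq0 ?qi_neq0.
have {}e : (-1) ^+ (parity n i * m) * qi s n i ^+ (m * 2) = 1.
  by rewrite exprM exprM expr2 mulrA -exprMn e mulVf.
have : s ^+ (twice_d n i * (m * 2) * 2) = 1.
  have := congr1 (fun y => y ^+ 2) e.
  rewrite exprMn expr1n -[(_ ^+ (_ * m)) ^+ 2]exprM -signr_odd oddM andbF mul1r.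
  by rewrite /qi -!exprM mulnA.
by apply/eqP/s_inf; rewrite !muln_gt0 twice_d_gt0 m0.
Qed.

Lemma qint_i_neq0 i m : (0 < m)%N -> qint_i s n i m != 0.
Proof.
move=> m0; rewrite /qint_i mulf_neq0 ?invr_neq0 ?qint_i_num_neq0 //.
by have := @qint_i_num_neq0 i 1 isT; rewrite !expr1.
Qed.

Lemma qint_i_den_neq0 i : (-1) ^+ parity n i * qi s n i - (qi s n i)^-1 != 0.
Proof. by have := @qint_i_num_neq0 i 1 isT; rewrite !expr1. Qed.

Lemma qi_subV_neq0 i : qi s n i - (qi s n i)^-1 != 0.
Proof.
rewrite subr_eq0; apply/eqP => e.
have : s ^+ (twice_d n i * 2) = 1.
  by rewrite exprM -/(qi s n i) expr2 {1}e mulVf ?qi_neq0.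
by apply/eqP/s_inf; rewrite muln_gt0 twice_d_gt0.
Qed.

Lemma qint_i1 i : qint_i s n i 1 = 1.
Proof. by rewrite /qint_i !expr1 divff // qint_i_den_neq0. Qed.

Lemma qint_i2 i :
  qint_i s n i 2 = (-1) ^+ parity n i * qi s n i + (qi s n i)^-1.
Proof.
apply/(mulIf (qint_i_den_neq0 i)); rewrite mulfVK ?qint_i_den_neq0 //.
by field; exact: qi_neq0.
Qed.

Lemma qint_i3 i :
  qint_i s n i 3 = qi s n i ^+ 2 + (-1) ^+ parity n i + qi s n i ^- 2.
Proof.
apply/(mulIf (qint_i_den_neq0 i)); rewrite mulfVK ?qint_i_den_neq0 //.
rewrite /parity; case: (_ == _); rewrite ?expr0 ?expr1.
  by field; exact: qi_neq0.
by field; exact: qi_neq0.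
Qed.

End QNumbers.

(** * Simple roots and the Cartan matrix *)

Ltac decide_bool b :=
  (have -> : b = true by lia) || (have -> : b = false by lia).
Ltac decide_bools :=
  repeat match goal with
  | |- context [nat_of_bool ?b] =>
      lazymatch b with
      | true => fail | false => fail | _ => decide_bool b
      end
  | |- context [if ?b then _ else _] =>
      lazymatch type of b with
      | bool => decide_bool b
      end
  end.

Section RootData.
Variable n : nat.
Implicit Types m : zvec n.

(** Since [std n n.+1 = 0], the last case includes [alpha_n = - e_n]. *)
Definition alpha (i : nat) : zvec n :=
  if i == 0%N then std n 1 *+ 2 else std n i.+1 - std n i.

Lemma std_last : std n n.+1 = 0.
Proof. by apply/ffunP => i; rewrite !ffunE eqSS ltn_eqF. Qed.

Lemma entry_last m : entry m n.+1 = 0.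
Proof. by rewrite /entry /= insubF // ltnn. Qed.

Lemma entry_alpha i p : (0 < p)%N ->
  entry (alpha i) p =
    if i == 0%N then (((1%N == p) && (p <= n)%N) * 2)%N%:Z
    else ((i.+1 == p) && (p <= n)%N)%:Z - ((i == p) && (p <= n)%N)%:Z.
Proof.
move=> p0; rewrite /alpha; case: ifP => _.
  by rewrite mulr2n entryD !entry_std //; lia.
by rewrite entryD entryN !entry_std.
Qed.

Lemma parityM i j : i != j -> (parity n i * parity n j = 0)%N.
Proof. by rewrite /parity; lia. Qed.

Lemma parity_mid i : (i < n)%N -> parity n i = 0%N.
Proof. by move=> lt; rewrite /parity ltn_eqF. Qed.

Lemma parity_last : parity n n = 1%N.
Proof. by rewrite /parity eqxx. Qed.

Hypothesis n_ge2 : (2 <= n)%N.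

Lemma serre_deg_far i j : (i <= n)%N -> (j <= n)%N ->
  i != j -> j != i.+1 -> i != j.+1 -> serre_deg n i j = 1%N.
Proof. by move=> *; rewrite /serre_deg /cartan; decide_bools. Qed.

Lemma serre_degS i : (0 < i < n)%N -> serre_deg n i i.+1 = 2.
Proof.
by move=> *; rewrite /serre_deg /cartan; repeat case: ifP => ?; lia.
Qed.

Lemma serre_deg_pred i : (0 < i)%N -> (i.+1 < n)%N -> serre_deg n i.+1 i = 2.
Proof. by move=> *; rewrite /serre_deg /cartan; decide_bools. Qed.

Lemma serre_deg_last i : (0 < i)%N -> i.+1 = n -> serre_deg n i.+1 i = 3.
Proof. by move=> *; rewrite /serre_deg /cartan; decide_bools. Qed.

End RootData.

(** * The structure constants of the Fock space *)

Section FockData.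
Variables (K : fieldType) (s x : K) (n : nat).
Hypothesis s_neq0 : s != 0.
Hypothesis s_inf : forall k, (0 < k)%N -> s ^+ k != 1.
Hypothesis x_neq0 : x != 0.
Hypothesis n_ge2 : (2 <= n)%N.
Local Notation q := (qpar s).
Local Notation ket := (@ket K n).
Local Notation alpha := (alpha n).
Local Notation "[ m ]_q" := (qint s m) (format "[ m ]_q").
Implicit Types m : zvec n.

(** For [i = n] the three coefficients have the shape they have for
    [1 <= i <= n - 1], up to a constant, because [entry m n.+1 = 0] and
    [[1] = 1]. *)
Definition ecoef (i : nat) m : K :=
  if i == 0%N then
    x * q^-1 * ([entry m 1 + 1]_q * [entry m 1 + 2]_q / [2]_q)
  else (if i == n then - s else 1) * [entry m i.+1 + 1]_q.

Definition fcoef (i : nat) m : K :=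
  if i == 0%N then - x^-1 * (q / [2]_q)
  else (if i == n then s^-1 else 1) * [entry m i + 1]_q.

Definition kcoef (i : nat) m : K :=
  if i == 0%N then q ^ (2 * entry m 1 + 1)
  else q ^ (- entry m i + entry m i.+1) * (if i == n then s^-1 else 1).

Ltac entries := rewrite ?(entry_alpha, entryD, entryN) //;
  try match goal with |- is_true (leq _ _) => by lia end; decide_bools.

(** The entry that the shift makes nonnegative is [-1] (or [-2], for [i = 0]),
    so that the coefficient has a factor [[0]]. *)
Lemma ecoef_boundary m i :
  (i <= n)%N -> ~~ zvec_nonneg m -> zvec_nonneg (m + alpha i) -> ecoef i m = 0.
Proof.
move=> le_in mneg /nonnegP mr.
have [p p1n mp] := neg_entry mneg.
have := mr p p1n; rewrite /ecoef entryD entry_alpha; last by lia.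
case: eqP => [i0|/eqP i0]; last first.
  move=> ge0; rewrite (_ : entry m i.+1 = -1) ?addNr.
    by apply/eqP; rewrite mulf_eq0 qint_eq0 ?orbT.
  by have [e|ne] := eqVneq i.+1 p; [rewrite e|]; lia.
move=> ge0; suff : (entry m 1 == -1) || (entry m 1 == - 2).
  by case/orP => /eqP ->; rewrite addNr /qint oppr0 subrr mul0r ?(mul0r, mulr0).
by move: mp ge0; have [<-|] := eqVneq 1%N p; lia.
Qed.

Lemma fcoef_boundary m i :
  (i <= n)%N -> ~~ zvec_nonneg m -> zvec_nonneg (m - alpha i) -> fcoef i m = 0.
Proof.
move=> le_in mneg /nonnegP mr.
have [p p1n mp] := neg_entry mneg.
move: (mr p p1n); rewrite /fcoef entryD entryN entry_alpha; last by lia.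
case: eqP => [i0|/eqP i0]; first by lia.
move=> ge0; rewrite (_ : entry m i = -1) ?addNr.
  by apply/eqP; rewrite mulf_eq0 qint_eq0 ?orbT.
by move: mp ge0; have [->|ne] := eqVneq i p; lia.
Qed.

Definition qexpD a b := expfzDr a b (qpar_neq0 s_neq0).

Lemma qexpN (a : int) : q ^ (- a) = (q ^ a)^-1.
Proof. by rewrite invr_expz. Qed.

Lemma qexpn (k : nat) : q ^ k = q ^+ k.
Proof. by []. Qed.

Ltac q_expand :=
  rewrite ?(qint2 s_neq0 s_inf) /qint ?natz
    ?(opprD, opprK, oppr0, addr0, add0r, subr0)
    ?(expr0z, expr1z, qexpn, qexpD, qexpN) ?(mul0n, mul1n, expr0).
(** The variables are [q] and the powers [q^{m_p}].  The inverses of [q - q^-1]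
    and [q + q^-1] are generalized: the identities solved here are homogeneous
    in them, so the definition of these two elements is not involved. *)
Ltac q_field :=
  q_expand;
  move: (q - q^-1)^-1 (q + q^-1)^-1 => ? ?;
  repeat match goal with |- context [qpar s ^ entry ?m ?p] =>
    move: (qpar s ^ entry m p)
      (@expfz_neq0 K (qpar s) (entry m p) (qpar_neq0 s_neq0)) => ? ?
  end;
  move: (qpar_neq0 s_neq0) => ?;
  field; rewrite ?oner_neq0; repeat (apply/andP; split); by [].

(** The only interactions are those of [e_i] with [f_{i+1}]: there the two
    coefficients depend on the same entry, and both operators shift it in the
    same direction. *)
Lemma ef_comm i j m : (i <= n)%N -> (j <= n)%N -> i != j ->
  ecoef i (m - alpha j) * fcoef j m = fcoef j (m + alpha i) * ecoef i m.
Proof.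
move=> le_i le_j ne; rewrite /ecoef /fcoef.
have [i0|i0] := eqVneq i 0%N.
  have [j1|j1] := eqVneq j 1%N; first by rewrite i0 j1; entries; q_field.
  by entries; q_field.
have [j0|j0] := eqVneq j 0%N; first by entries; rewrite subr0 mulrC.
have [e|e] := eqVneq j i.+1; first by rewrite e; entries; q_field.
by entries; q_field.
Qed.

Lemma qi0 : qi s n 0 = q ^+ 2.
Proof. by rewrite /qi /qpar -exprM. Qed.

Lemma qi_mid i : (0 < i < n)%N -> qi s n i = q.
Proof. by rewrite /qi /qpar /twice_d => i1; decide_bools. Qed.

Lemma qi_last : qi s n n = s.
Proof. by rewrite /qi /twice_d; decide_bools. Qed.

(** Instances of [[a + 1][b] - [b + 1][a] = [b - a]]; for [i = 0] of
    [[a + 1][a + 2] - [a - 1][a] = [2][2a + 1]]; and for [i = n] of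
    [[a + 1] + [a] = (q^{a + 1/2} - q^{- a - 1/2}) / (q^{1/2} - q^{- 1/2})]. *)
Lemma ef_diag i m : (i <= n)%N ->
  ecoef i (m - alpha i) * fcoef i m
    - (-1) ^+ (parity n i * parity n i) * (fcoef i (m + alpha i) * ecoef i m) =
  (qi s n i - (qi s n i)^-1)^-1 * (kcoef i m - (kcoef i m)^-1).
Proof.
move=> le_i; apply: (mulfI (qi_subV_neq0 s_neq0 s_inf n i)).
rewrite mulVKf ?qi_subV_neq0 //.
have q0 := qpar_neq0 s_neq0.
have qB : q * q - 1 != 0.
  have /(mulf_neq0 q0) := qpar_subV_neq0 s_neq0 s_inf.
  by rewrite mulrBr mulfV.
have qD : q * q + 1 != 0.
  have /(mulf_neq0 q0) := qpar_addV_neq0 s_neq0 s_inf.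
  by rewrite mulrDr mulfV.
rewrite /ecoef /fcoef /kcoef /parity.
have [->|i0] := eqVneq i 0%N.
  entries; rewrite qi0 (_ : 2 * entry m 1 = entry m 1 + entry m 1); last lia.
  q_expand.
  move: (q ^ entry m 1) (expfz_neq0 (entry m 1) (qpar_neq0 s_neq0)) => A A0.
  by field; rewrite q0 A0 qB qD x_neq0.
have [e|ne] := eqVneq i n.
  rewrite e; entries; rewrite qi_last entry_last; q_expand.
  move: (q ^ entry m n) (expfz_neq0 (entry m n) (qpar_neq0 s_neq0)) => A A0.
  move: qB; rewrite /qpar => qB.
  rewrite /= expr1; field.
  by rewrite s_neq0 A0 oner_neq0 -!expr2 -exprM in qB *.
rewrite qi_mid; last by lia.
entries; q_expand.
move: (q ^ entry m i) (expfz_neq0 (entry m i) (qpar_neq0 s_neq0)) => A A0.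
move: (q ^ entry m i.+1) (expfz_neq0 (entry m i.+1) (qpar_neq0 s_neq0)).
by move=> B B0; field; rewrite q0 A0 B0 qB.
Qed.

(** The eigenvalue of [k_i] is [q] to an affine form in [m] with linear part
    [L], and [L(alpha_j) = d_i a_ij]. *)
Lemma kcoef_alpha i j m : (i <= n)%N -> (j <= n)%N ->
  kcoef i (m + alpha j) = qi s n i ^ cartan n i j * kcoef i m.
Proof.
move=> le_i le_j.
pose L := if i == 0%N then 2 * entry (alpha j) 1
          else - entry (alpha j) i + entry (alpha j) i.+1.
have -> : kcoef i (m + alpha j) = q ^ L * kcoef i m.
  rewrite /kcoef /L !entryD; case: ifP => _.
    by rewrite -qexpD; congr (_ ^ _); lia.
  by rewrite mulrA -qexpD; congr (_ ^ _ * _); lia.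
congr (_ * _); rewrite qexpz /qi exprnP exprz_exp; congr (_ ^ _).
rewrite /L /cartan /twice_d; have [i0|i0] := eqVneq i 0%N.
  by rewrite i0 entry_alpha //; repeat case: ifP => ?; lia.
by rewrite !entry_alpha //; [repeat case: ifP => ?; lia|lia].
Qed.

Let b1 := qint_i1 s_neq0 s_inf n.
Let b2 i : qint_i s n i 2 != 0 := @qint_i_neq0 _ _ s_neq0 s_inf n i 2 isT.
Let b3 i : qint_i s n i 3 != 0 := @qint_i_neq0 _ _ s_neq0 s_inf n i 3 isT.

(** Distant operators commute. For neighbours, the identity says that a
    difference operator kills a coefficient function; for [(i, j) = (n, n -
    1)], where [i] is odd, the signs give this operator the characteristic
    roots [-1, q, q^-1] instead of the usual [q^-2, 1, q^2]. *)
Lemma serre_coef_e i j m : (i <= n)%N -> (j <= n)%N -> i != j ->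
  serre_coef s (ecoef i) (ecoef j) (alpha i) (alpha j) i j m = 0.
Proof.
move=> le_i le_j ne; have pij := parityM n ne.
have [far|near] := boolP ((j != i.+1) && (i != j.+1)).
  case/andP: far => f1 f2.
  apply: serre_coef1 (serre_deg_far n_ge2 le_i le_j ne f1 f2) _ => //.
  rewrite /ecoef.
  by case: (eqVneq i 0%N) => i0; case: (eqVneq j 0%N) => j0; entries; q_field.
have [{}near|{}near] : j = i.+1 \/ i = j.+1 by lia.
  move: le_j ne pij; rewrite near => le_j ne pij.
  have par : parity n i = 0%N by rewrite parity_mid.
  have [i0|i0] := eqVneq i 0%N.
    apply: serre_coef2 => //; first by rewrite i0.
    by rewrite (qint_i2 s_neq0 s_inf) par i0 qi0 /ecoef; entries; q_field.
  apply: serre_coef2 => //; first by rewrite serre_degS; lia.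
  rewrite (qint_i2 s_neq0 s_inf) par qi_mid; last by lia.
  by rewrite /ecoef; entries; q_field.
move: le_i ne pij; rewrite near => le_i ne pij.
have [j0|j0] := eqVneq j 0%N.
  rewrite j0 in pij *; apply: serre_coef3 => //.
  rewrite (qint_i3 s_neq0 s_inf) parity_mid ?qi_mid; try by lia.
  by rewrite /ecoef; entries; q_field.
have [jn|jn] := eqVneq j.+1 n.
  apply: serre_coef3 => //; first by rewrite serre_deg_last; lia.
  have [pn qn] : parity n j.+1 = 1%N /\ qi s n j.+1 = s.
    by rewrite jn parity_last qi_last.
  rewrite (qint_i3 s_neq0 s_inf) pn qn /ecoef -/(qpar s).
  by entries; q_field.
apply: serre_coef2 => //; first by rewrite serre_deg_pred; lia.
rewrite (qint_i2 s_neq0 s_inf) parity_mid ?qi_mid; try by lia.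
by rewrite /ecoef; entries; q_field.
Qed.

Lemma serre_coef_f i j m : (i <= n)%N -> (j <= n)%N -> i != j ->
  serre_coef s (fcoef i) (fcoef j) (- alpha i) (- alpha j) i j m = 0.
Proof.
move=> le_i le_j ne; have pij := parityM n ne.
have [far|near] := boolP ((j != i.+1) && (i != j.+1)).
  case/andP: far => f1 f2.
  apply: serre_coef1 (serre_deg_far n_ge2 le_i le_j ne f1 f2) _ => //.
  rewrite /fcoef.
  by case: (eqVneq i 0%N) => i0; case: (eqVneq j 0%N) => j0; entries; q_field.
have [{}near|{}near] : j = i.+1 \/ i = j.+1 by lia.
  move: le_j ne pij; rewrite near => le_j ne pij.
  have par : parity n i = 0%N by rewrite parity_mid.
  have [i0|i0] := eqVneq i 0%N.
    apply: serre_coef2 => //; first by rewrite i0.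
    by rewrite (qint_i2 s_neq0 s_inf) par i0 qi0 /fcoef /=; entries; q_field.
  apply: serre_coef2 => //; first by rewrite serre_degS; lia.
  rewrite (qint_i2 s_neq0 s_inf) par qi_mid; last by lia.
  by rewrite /fcoef; entries; q_field.
move: le_i ne pij; rewrite near => le_i ne pij.
have [j0|j0] := eqVneq j 0%N.
  rewrite j0 in pij *; apply: serre_coef3 => //.
  rewrite (qint_i3 s_neq0 s_inf) parity_mid ?qi_mid; try by lia.
  by rewrite /fcoef /=; entries; q_field.
have [jn|jn] := eqVneq j.+1 n.
  apply: serre_coef3 => //; first by rewrite serre_deg_last; lia.
  have [pn qn] : parity n j.+1 = 1%N /\ qi s n j.+1 = s.
    by rewrite jn parity_last qi_last.
  rewrite (qint_i3 s_neq0 s_inf) pn qn /fcoef -/(qpar s).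
  by entries; q_field.
apply: serre_coef2 => //; first by rewrite serre_deg_pred; lia.
rewrite (qint_i2 s_neq0 s_inf) parity_mid ?qi_mid; try by lia.
by rewrite /fcoef; entries; q_field.
Qed.

(** * The module structure *)

Definition gen_coef (g : Ugen n) m : K :=
  match g with
  | GenE i => ecoef i m
  | GenF i => fcoef i m
  | GenK i => kcoef i m
  | GenKinv i => (kcoef i m)^-1
  | GenSigma => (-1) ^ zvec_size m
  end.

Definition gen_shift (g : Ugen n) : zvec n :=
  match g with
  | GenE i => alpha i
  | GenF i => - alpha i
  | _ => 0
  end.

Definition FockT (g : Ugen n) : {linear Fock K n -> Fock K n} :=
  wshift (gen_coef g) (gen_shift g).

Lemma gen_coef_boundary g m :
  ~~ zvec_nonneg m -> zvec_nonneg (m + gen_shift g) -> gen_coef g m = 0.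
Proof.
case: g => [i|i|i|i|] /= mneg; try by rewrite addr0 (negbTE mneg).
  by apply: ecoef_boundary => //; rewrite -ltnS.
by apply: fcoef_boundary => //; rewrite -ltnS.
Qed.

Lemma gen_shifts g : shifts FockT (free_gen K g) (gen_coef g) (gen_shift g).
Proof.
by move=> m; rewrite Uact_gen; exact: (wshift_ket (@gen_coef_boundary g)).
Qed.

Lemma kcoef_neq0 i m : kcoef i m != 0.
Proof.
have q0 := qpar_neq0 s_neq0.
rewrite /kcoef; case: ifP => _; first by rewrite expfz_neq0.
by rewrite mulf_neq0 ?expfz_neq0 //; case: ifP; rewrite ?oner_neq0 ?invr_neq0.
Qed.

Lemma sign_size_alpha i : (i <= n)%N ->
  (-1) ^ zvec_size (alpha i) = (-1) ^+ parity n i :> K.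
Proof.
move=> le_i; rewrite /(alpha _); case: (eqVneq i 0%N) => i0.
  rewrite mulr2n zvec_sizeD zvec_size_std parity_mid; last by lia.
  rewrite (_ : (0 < 1 <= n)%N = true); last by lia.
  by rewrite expr0 -[LHS]/((-1) ^+ 2) sqrrN expr1n.
rewrite zvec_sizeD zvec_sizeN !zvec_size_std /parity.
have [->|ne] := eqVneq i n.
  rewrite (_ : (0 < n.+1 <= n)%N = false); last by lia.
  rewrite (_ : (0 < n <= n)%N = true); last by lia.
  by rewrite sub0r exprN1 invrN1 expr1.
rewrite (_ : (0 < i.+1 <= n)%N = true); last by lia.
by rewrite (_ : (0 < i <= n)%N = true) ?subrr //; lia.
Qed.

Lemma sign_size_add m d :
  (-1) ^ zvec_size (m + d) = (-1) ^ zvec_size d * (-1) ^ zvec_size m :> K.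
Proof. by rewrite zvec_sizeD addrC expfzDr // oppr_eq0 oner_neq0. Qed.

Lemma Usigma_rel_act u u' : Usigma_rel s (n:=n) u u' ->
  forall v, Uact FockT u v = Uact FockT u' v.
Proof.
have le (i : 'I_n.+1) : (i <= n)%N by rewrite -ltnS.
pose act1 g := gen_shifts g.
pose act2 g h := shiftsM (act1 g) (act1 h).
pose act3 g h l := shiftsM (act2 g h) (act1 l).
move=> r; apply: Uact_ext => m _; case: r => {u u'}.
- move=> i j; apply: etrans (act2 (GenK i) (GenK j) m) _.
  by apply: etrans _ (esym (act2 (GenK j) (GenK i) m)); rewrite /= !addr0 mulrC.
- move=> i; rewrite (act2 (GenK i) (GenKinv i) m) Uact1 /= !addr0.
  by rewrite mulfV ?kcoef_neq0 ?scale1r.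
- move=> i; rewrite (act2 (GenKinv i) (GenK i) m) Uact1 /= !addr0.
  by rewrite mulVf ?kcoef_neq0 ?scale1r.
- move=> i j; rewrite (act3 (GenK i) (GenE j) (GenKinv i) m).
  rewrite UactZ (act1 (GenE j) m) /= scalerA !addr0 add0r kcoef_alpha //.
  by congr (_ *: _); field; exact: kcoef_neq0.
- move=> i j; rewrite (act3 (GenK i) (GenF j) (GenKinv i) m).
  rewrite UactZ (act1 (GenF j) m) /= scalerA !addr0 add0r.
  have -> : kcoef i m = kcoef i (m - alpha j + alpha j) by rewrite subrK.
  rewrite kcoef_alpha // -invr_expz; congr (_ *: _); field.
  by rewrite kcoef_neq0 expfz_neq0 ?qi_neq0.
- move=> i j; rewrite UactB UactZ.
  apply: etrans (congr2 (fun v w => v - _ *: w) (act2 (GenE i) (GenF j) m)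
    (act2 (GenF j) (GenE i) m)) _.
  rewrite /= scalerA [alpha i - alpha j]addrC -scalerBl.
  case: eqP => [<-|/eqP ne].
    rewrite UactZ UactB (act1 (GenK i) m) (act1 (GenKinv i) m) /=.
    by rewrite !addr0 addNr addr0 -scalerBl scalerA ef_diag.
  by rewrite Uact0 parityM // expr0 mul1r ef_comm // subrr scale0r.
- move=> i j ne; rewrite (serre_shifts s (act1 (GenE i)) (act1 (GenE j)) i j m).
  by rewrite Uact0 serre_coef_e ?scale0r.
- move=> i j ne; rewrite (serre_shifts s (act1 (GenF i)) (act1 (GenF j)) i j m).
  by rewrite Uact0 serre_coef_f ?scale0r.
- rewrite (act2 GenSigma GenSigma m) Uact1 /= !addr0.
  by rewrite -expfzMl mulrNN mulr1 exp1rz scale1r.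
- move=> i; apply: etrans (act2 GenSigma (GenK i) m) _.
  by apply: etrans _ (esym (act2 (GenK i) GenSigma m)); rewrite /= !addr0 mulrC.
- move=> i; rewrite UactZ; apply: etrans (act2 GenSigma (GenE i) m) _.
  rewrite (act2 (GenE i) GenSigma m) /= !addr0 add0r scalerA.
  rewrite sign_size_add sign_size_alpha //.
  by congr (_ *: _); ring.
move=> i; rewrite UactZ; apply: etrans (act2 GenSigma (GenF i) m) _.
rewrite (act2 (GenF i) GenSigma m) /= !addr0 add0r scalerA; congr (_ *: _).
have -> : (-1) ^ zvec_size m = (-1) ^ zvec_size (m - alpha i + alpha i) :> K.
  by rewrite subrK.
rewrite [in RHS]sign_size_add sign_size_alpha //.
have sign2 : (-1) ^+ parity n i * (-1) ^+ parity n i = 1 :> K.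
  by rewrite -expr2 -exprM muln2 -signr_odd odd_double.
by rewrite -[LHS]mul1r -{1}sign2; ring.
Qed.

(** The part of the formulas that concerns [g], in the uniform notation. *)
Definition acts_by_shift
    (act : Usigma s n -> Fock K n -> Fock K n) (g : Ugen n) :=
  forall m, zvec_nonneg m ->
  act (palg_gen (Usigma_rel s (n:=n)) g) (ket m) =
    gen_coef g m *: ket (m + gen_shift g).

Lemma qint1 : [1]_q = 1.
Proof. by rewrite /qint expr1z exprN1 divff // qpar_subV_neq0. Qed.

Lemma inord_ind (P : 'I_n.+1 -> Prop) :
  P (inord 0) -> (forall j, (1 <= j <= n.-1)%N -> P (inord j)) -> P (inord n) ->
  forall i, P i.
Proof.
move=> P0 Pj Pn i; rewrite -[i]inord_val.
have [->//|i0] := eqVneq (val i) 0%N.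
have [->//|ne] := eqVneq (val i) n.
by apply: Pj; have := ltn_ord i; rewrite /= in i0 ne *; lia.
Qed.

Lemma Fock_formulasP (act : Usigma s n -> Fock K n -> Fock K n) :
  Fock_formulas x act <->
  [/\ forall i, acts_by_shift act (GenE i),
      forall i, acts_by_shift act (GenF i),
      forall i, acts_by_shift act (GenK i) & acts_by_shift act GenSigma].
Proof.
have ord0 : val (inord 0 : 'I_n.+1) = 0%N by rewrite /= inordK.
have ordn : val (inord n : 'I_n.+1) = n by rewrite /= inordK.
have ordj j : (1 <= j <= n.-1)%N ->
    [/\ val (inord j : 'I_n.+1) = j, j != 0%N & j != n].
  by move=> ?; rewrite /= inordK; [split|]; lia.
have n0 : n != 0%N by lia.
have E0 m : gen_coef (GenE (inord 0)) m *:
      ket (m + gen_shift (GenE (inord 0))) =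
    (x * q^-1 * ([entry m 1 + 1]_q * [entry m 1 + 2]_q / [2]_q)) *:
        ket (m + std n 1 *+ 2).
  by rewrite /= ord0.
have F0 m : gen_coef (GenF (inord 0)) m *:
      ket (m + gen_shift (GenF (inord 0))) =
    (- x^-1 * (q / [2]_q)) *: ket (m - std n 1 *+ 2).
  by rewrite /= ord0.
have K0 m : gen_coef (GenK (inord 0)) m *:
      ket (m + gen_shift (GenK (inord 0))) =
    q ^ (2 * entry m 1 + 1) *: ket m.
  by rewrite /= ord0 addr0.
have Ej m j : (1 <= j <= n.-1)%N ->
    gen_coef (GenE (inord j)) m *: ket (m + gen_shift (GenE (inord j))) =
    [entry m j.+1 + 1]_q *: ket (m - std n j + std n j.+1).
  case/ordj => /= -> /negbTE j0 /negbTE jn.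
  by rewrite /ecoef /(alpha _) j0 jn mul1r addrA addrAC.
have Fj m j : (1 <= j <= n.-1)%N ->
    gen_coef (GenF (inord j)) m *: ket (m + gen_shift (GenF (inord j))) =
    [entry m j + 1]_q *: ket (m + std n j - std n j.+1).
  case/ordj => /= -> /negbTE j0 /negbTE jn.
  by rewrite /fcoef /(alpha _) j0 jn mul1r opprB addrA.
have Kj m j : (1 <= j <= n.-1)%N ->
    gen_coef (GenK (inord j)) m *: ket (m + gen_shift (GenK (inord j))) =
    q ^ (- entry m j + entry m j.+1) *: ket m.
  case/ordj => /= -> /negbTE j0 /negbTE jn.
  by rewrite /kcoef j0 jn mulr1 addr0.
have En m : gen_coef (GenE (inord n)) m *:
      ket (m + gen_shift (GenE (inord n))) =
    - s *: ket (m - std n n).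
  rewrite /= ordn /ecoef /(alpha _) (negbTE n0) eqxx std_last sub0r entry_last.
  by rewrite add0r qint1 mulr1.
have Fn m : gen_coef (GenF (inord n)) m *:
      ket (m + gen_shift (GenF (inord n))) =
    (s^-1 * [entry m n + 1]_q) *: ket (m + std n n).
  by rewrite /= ordn /fcoef /(alpha _) (negbTE n0) eqxx std_last sub0r opprK.
have Kn m : gen_coef (GenK (inord n)) m *:
      ket (m + gen_shift (GenK (inord n))) =
    (q ^ (- entry m n) * s^-1) *: ket m.
  by rewrite /= ordn /kcoef (negbTE n0) eqxx entry_last !addr0.
have S m : gen_coef GenSigma m *: ket (m + gen_shift GenSigma) =
    (-1) ^ zvec_size m *: ket m by rewrite /= addr0.
split=> [[e0 f0 k0 ej fj kj en fn kn sg]|[rE rF rK rS]].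
  split.
  - apply: inord_ind => [m m0|j j1 m m0|m m0].
    + exact (etrans (e0 m m0) (esym (E0 m))).
    + exact (etrans (ej m j m0 j1) (esym (Ej m j j1))).
    + exact (etrans (en m m0) (esym (En m))).
  - apply: inord_ind => [m m0|j j1 m m0|m m0].
    + exact (etrans (f0 m m0) (esym (F0 m))).
    + exact (etrans (fj m j m0 j1) (esym (Fj m j j1))).
    + exact (etrans (fn m m0) (esym (Fn m))).
  - apply: inord_ind => [m m0|j j1 m m0|m m0].
    + exact (etrans (k0 m m0) (esym (K0 m))).
    + exact (etrans (kj m j m0 j1) (esym (Kj m j j1))).
    + exact (etrans (kn m m0) (esym (Kn m))).
  - move=> m m0; exact (etrans (sg m m0) (esym (S m))).
split.
- move=> m m0; exact (etrans (rE _ m m0) (E0 m)).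
- move=> m m0; exact (etrans (rF _ m m0) (F0 m)).
- move=> m m0; exact (etrans (rK _ m m0) (K0 m)).
- move=> m j m0 j1; exact (etrans (rE _ m m0) (Ej m j j1)).
- move=> m j m0 j1; exact (etrans (rF _ m m0) (Fj m j j1)).
- move=> m j m0 j1; exact (etrans (rK _ m m0) (Kj m j j1)).
- move=> m m0; exact (etrans (rE _ m m0) (En m)).
- move=> m m0; exact (etrans (rF _ m m0) (Fn m)).
- move=> m m0; exact (etrans (rK _ m m0) (Kn m)).
- move=> m m0; exact (etrans (rS m m0) (S m)).
Qed.

Definition Fock_act : Usigma s n -> Fock K n -> Fock K n :=
  @palg_act K (Ugen n) (Fock K n) (Usigma_rel s (n:=n)) FockT.

Lemma Fock_act_is_module : is_module Fock_act.
Proof. exact: palg_act_is_module Usigma_rel_act. Qed.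

Lemma Fock_act_formulas : Fock_formulas x Fock_act.
Proof.
suff r g : acts_by_shift Fock_act g.
  by apply/Fock_formulasP; split=> *; exact: r.
move=> m _; rewrite /Fock_act (palg_act_gen Usigma_rel_act).
exact: (wshift_ket (@gen_coef_boundary g)).
Qed.

Lemma genKK' i :
  palg_gen (Usigma_rel s (n:=n)) (GenK i) * palg_gen _ (GenKinv i) = 1.
Proof.
rewrite -palg_piM; apply/palg_piP; apply: rel_ideal_rel; exact: rel_kk'.
Qed.

Lemma genK'K i :
  palg_gen (Usigma_rel s (n:=n)) (GenKinv i) * palg_gen _ (GenK i) = 1.
Proof.
rewrite -palg_piM; apply/palg_piP; apply: rel_ideal_rel; exact: rel_k'k.
Qed.

Lemma Fock_module_unique (act act' : Usigma s n -> Fock K n -> Fock K n) :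
  is_module act -> Fock_formulas x act ->
  is_module act' -> Fock_formulas x act' -> forall a v, act a v = act' a v.
Proof.
move=> mod /Fock_formulasP [rE rF rK rS] mod' /Fock_formulasP [rE' rF' rK' rS'].
have eq_gen g : acts_by_shift act g -> acts_by_shift act' g ->
    forall v, act (palg_gen _ g) v = act' (palg_gen _ g) v.
  move=> r r'; apply: Fock_linear_ind => [|c u v IHu IHv|m m0].
  - by rewrite !module_act0.
  - by rewrite (module_act_linear_r mod) (module_act_linear_r mod') IHu IHv.
  - by rewrite r ?r'.
apply: (module_ext mod mod') => g; case: g => [i|i|i|i|].
- exact (eq_gen _ (rE i) (rE' i)).
- exact (eq_gen _ (rF i) (rF' i)).
- exact (eq_gen _ (rK i) (rK' i)).
- have eqK := eq_gen _ (rK i) (rK' i).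
  move=> v; set k' := palg_gen _ _.
  (* k' acts as an inverse of k under both structures, and k acts equally *)
  have e : act k' (act (palg_gen _ (GenK i)) (act' k' v)) = act' k' v.
    by rewrite -(module_actM mod) /k' genK'K (module_act1 mod).
  rewrite -e eqK -(module_actM mod') genKK' (module_act1 mod').
  reflexivity.
exact (eq_gen _ rS rS').
Qed.

(** * Irreducibility *)

(** The eigenvalue of [k_n] gives [m_n], and that of [k_p] then gives [m_p] from
    [m_{p+1}]: the induction runs down from [entry m n.+1 = 0]. *)
Lemma kcoef_inj m m' :
  (forall i, (i <= n)%N -> kcoef i m = kcoef i m') -> m = m'.
Proof.
move=> eqk; have n0 : n != 0%N by lia.
have eq_entry p : (0 < p <= n.+1)%N -> entry m p = entry m' p.
  move=> p1; have -> : p = (n.+1 - (n.+1 - p))%N by lia.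
  have : (n.+1 - p <= n)%N by lia.
  elim: (n.+1 - p)%N => [_|k IH lek]; first by rewrite subn0 !entry_last.
  have {IH} eqS := IH (ltnW lek).
  have := eqk (n.+1 - k.+1)%N; rewrite subSS leq_subr => /(_ isT).
  have ne0 : ((n - k)%N == 0%N) = false by lia.
  have last_neq0 : (if (n - k)%N == n then s^-1 else 1) != 0.
    by case: ifP; rewrite ?invr_neq0 ?oner_neq0.
  rewrite /kcoef ne0; have -> : (n - k).+1 = (n.+1 - k)%N by lia.
  rewrite eqS => /(mulIf last_neq0).
  by move/(qexpz_inj s_neq0 s_inf); lia.
apply/ffunP => i; rewrite -!entryE eq_entry //.
by have := ltn_ord i; lia.
Qed.

(** The number of moves [e_p] with [1 <= p <= n] that bring [|m>] to [|0>]: a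
    particle at position [p] needs [n + 1 - p] of them to be pushed out. *)
Definition moment m : int := \sum_(i < n) m i *+ (n - i).

Lemma momentD m d : moment (m + d) = moment m + moment d.
Proof.
by rewrite -big_split; apply: eq_bigr => i _; rewrite ffunE mulrnDl.
Qed.

Lemma momentN m : moment (- m) = - moment m.
Proof. by rewrite -sumrN; apply: eq_bigr => i _; rewrite ffunE mulNrn. Qed.

Lemma moment_std p : (0 < p <= n.+1)%N -> moment (std n p) = (n.+1 - p)%N%:Z.
Proof.
case: p => // p /=; rewrite ltnS => le_p; rewrite subSS.
have [->|ne] := eqVneq p n.
  by rewrite std_last subnn /moment big1 // => i _; rewrite ffunE mul0rn.
have lt_p : (p < n)%N by lia.
rewrite /moment (bigD1 (Ordinal lt_p)) //= ffunE eqxx big1 ?addr0 => [|i neq].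
  by rewrite -[RHS]natz.
rewrite ffunE eqSS -[p in _ == p]/(val (Ordinal lt_p)) val_eqE (negbTE neq).
by rewrite mul0rn.
Qed.

Lemma moment_alpha p : (0 < p <= n)%N -> moment (alpha p) = -1.
Proof.
move=> p1; rewrite /(alpha _) ifF; last by lia.
by rewrite momentD momentN !moment_std; lia.
Qed.

Lemma moment_ge0 m : zvec_nonneg m -> 0 <= moment m.
Proof.
by move=> /forallP m0; apply: sumr_ge0 => i _; rewrite mulrn_wge0 ?m0.
Qed.

Lemma alpha_nonneg m p : (0 < p <= n)%N -> zvec_nonneg m -> 0 < entry m p ->
  zvec_nonneg (m + alpha p).
Proof.
move=> p1 /nonnegP m0 mp; apply/nonnegP => r r1.
rewrite entryD entry_alpha; last by lia.
rewrite ifF; last by lia.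
by have := m0 r r1; have [<-|] := eqVneq p r; lia.
Qed.

Section Irreducible.
Variable act : Usigma s n -> Fock K n -> Fock K n.
Hypothesis act_mod : is_module act.
Hypothesis act_ket : Fock_formulas x act.
Variable P : Fock K n -> Prop.
Hypothesis subP : is_submodule act P.

Lemma submodZ c v : P v -> P (c *: v).
Proof.
move=> Pv; rewrite -[_ *: _]addr0.
exact (submodule_linear subP c Pv (submodule0 subP)).
Qed.

Lemma submodZ_inv c v : c != 0 -> P (c *: v) -> P v.
Proof. by move=> c0 /(submodZ c^-1); rewrite scalerA mulVf // scale1r. Qed.

(** [e_p] goes from left to right and [f_p] back; the coefficients are
    [[m_{p+1} + 1]] and [[m_p]] up to units, hence nonzero. *)
Lemma submod_shift m p : (0 < p <= n)%N -> zvec_nonneg m -> 0 < entry m p ->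
  P (ket m) <-> P (ket (m + alpha p)).
Proof.
move=> p1 m0 mp; have [rE rF _ _] := (Fock_formulasP act).1 act_ket.
have le_p : (p < n.+1)%N by lia.
have m'0 := alpha_nonneg p1 m0 mp.
have mp0 r : 0 <= entry m r := entry_nonneg r m0.
have u0 b u : u != 0 -> (if b : bool then u else 1) != 0 :> K.
  by move=> ?; case: b; rewrite ?oner_neq0.
split => [/(submodule_act subP (palg_gen _ (GenE (Ordinal le_p))))|
          /(submodule_act subP (palg_gen _ (GenF (Ordinal le_p))))].
  rewrite (rE _ _ m0); apply: submodZ_inv => /=.
  rewrite /ecoef ifF; last by lia.
  rewrite mulf_neq0 ?u0 ?oppr_eq0 // qint_eq0 //.
  by have := mp0 p.+1; lia.
rewrite (rF _ _ m'0) /= addrK; apply: submodZ_inv.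
rewrite /fcoef ifF; last by lia.
rewrite mulf_neq0 ?u0 ?invr_neq0 // qint_eq0 // entryD entry_alpha; last by lia.
by rewrite ifF; lia.
Qed.

Lemma submod_ket m : zvec_nonneg m -> P (ket m) <-> P (ket 0).
Proof.
move=> m0; have [k] := ubnP `|moment m|%N; elim: k m m0 => // k IH m m0 ltk.
have [->//|mN0] := eqVneq m 0.
have [p p1 mp] : exists2 p, (0 < p <= n)%N & 0 < entry m p.
  apply/not_exists2P => all_le; case/eqP: mN0; apply/ffunP => i.
  case: (all_le i.+1) => [|/negP]; first by rewrite /= ltn_ord.
  rewrite -leNgt entryE ffunE => le0.
  by apply/le_anti; rewrite le0 (forallP m0).
apply: iff_trans (submod_shift p1 m0 mp) _.
apply: IH; first exact: alpha_nonneg.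
rewrite momentD moment_alpha //.
have := moment_ge0 m0; have := moment_ge0 (alpha_nonneg p1 m0 mp).
by rewrite momentD moment_alpha //; lia.
Qed.

Lemma K_diagonal (i : 'I_n.+1) v mm :
  (act (palg_gen _ (GenK i)) v : {malg K[_]})@_mm = kcoef i (natvec mm) * v@_mm.
Proof.
have [_ _ rK _] := (Fock_formulasP act).1 act_ket.
move: v; apply: Fock_linear_ind => [|c u v IHu IHv|m m0].
- by rewrite module_act0 // mcoeff0 mulr0.
- rewrite (module_act_linear_r act_mod) !mcoeffD !mcoeffZ IHu IHv.
  by rewrite mulrDr mulrCA.
rewrite (rK _ _ m0) /= addr0 mcoeffZ (nonneg_natvec m0) ket_natvec mcoeffU.
by case: eqVneq => [->|] //; rewrite !mulr0.
Qed.

(** If two kets occur in [v], some [k_i] tells them apart, and subtracting from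
    [k_i v] the multiple of [v] by one of the two eigenvalues removes one ket
    and keeps the other. *)
Lemma submod_has_ket v : P v -> v != 0 -> exists2 m, zvec_nonneg m & P (ket m).
Proof.
have [k] := ubnP #|` msupp v|; elim: k v => // k IH v ltk Pv vN0.
have [mm vmm] : exists mm, mm \in msupp v.
  apply: contrapT => /forallNP out; case/eqP: vN0; apply/malgP => mm.
  by rewrite mcoeff0; apply: mcoeff_outdom; apply/negP/out.
have [single|] := pselect (forall mm', mm' \in msupp v -> mm' = mm).
  exists (natvec mm); first exact: natvec_nonneg.
  apply: (@submodZ_inv v@_mm); first by rewrite mcoeff_neq0.
  suff <- : v = v@_mm *: ket (natvec mm) by [].
  apply/malgP => mm'; rewrite ket_natvec mcoeffZ mcoeffU.
  case: eqVneq => [->|ne]; first by rewrite mulr1.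
  rewrite mulr0; apply: mcoeff_outdom; apply/negP => /single e.
  by rewrite e eqxx in ne.
move=> /existsNP [mm' /not_implyP [vmm' ne]].
have [i le_i kne] : exists2 i, (i <= n)%N &
    kcoef i (natvec mm) <> kcoef i (natvec mm').
  apply/not_exists2P => all_eq; apply: ne; apply/ffunP => r.
  have /(congr1 (fun m : zvec n => m r)) : natvec mm' = natvec mm.
    apply: kcoef_inj => i le_i.
    by case: (all_eq i) => // /contrapT.
  by rewrite !ffunE => -[].
have [i' ei] : exists i' : 'I_n.+1, val i' = i.
  by exists (Ordinal (le_i : (i < n.+1)%N)).
pose w : Fock K n :=
  (- kcoef i (natvec mm)) *: v + act (palg_gen _ (GenK i')) v.
have Pw : P w by exact (submodule_linear subP _ Pv (submodule_act subP _ Pv)).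
have wE r : w@_r = (kcoef i (natvec r) - kcoef i (natvec mm)) * v@_r.
  by rewrite /w mcoeffD mcoeffZ K_diagonal ei; ring.
apply: IH Pw _; last first.
  apply/eqP => w0; have := wE mm'; rewrite w0 mcoeff0 => /esym/eqP.
  rewrite mulf_eq0 mcoeff_eq0 vmm' orbF subr_eq0 => /eqP e; exact: kne.
apply: leq_trans (_ : #|` msupp v| <= k)%N; last by rewrite -ltnS.
apply: fproper_ltn_card; rewrite fproperE; apply/andP; split.
  apply/fsubsetP => r; rewrite -!mcoeff_neq0 wE mulf_eq0 negb_or.
  by case/andP.
apply/fsubsetPn; exists mm => //.
by rewrite -mcoeff_eq0 wE subrr mul0r.
Qed.

Lemma submod_full v : P v -> v != 0 -> forall w, P w.
Proof.
move=> Pv v0; have [m m0 /(submod_ket m0) P0] := submod_has_ket Pv v0.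
apply: Fock_linear_ind => [|c u w Pu Pw|m' m'0]; first exact (submodule0 subP).
  exact (submodule_linear subP c Pu Pw).
by apply/(submod_ket m'0).
Qed.

End Irreducible.

Theorem Fock_irreducible (act : Usigma s n -> Fock K n -> Fock K n) :
  is_module act -> Fock_formulas x act -> irreducible_module act.
Proof.
move=> mod form; split.
  exists (ket 0); have -> : 0 = natvec [ffun=> 0%N] :> zvec n.
    by apply/ffunP => i; rewrite !ffunE.
  rewrite ket_natvec => /malgP /(_ [ffun=> 0%N]) /eqP.
  by rewrite mcoeffUU mcoeff0 oner_eq0.
move=> P subP; have [[v [Pv v0]]|none] := pselect (exists v, P v /\ v <> 0).
  by right; apply: (submod_full mod form subP Pv); exact/eqP.
by left=> v Pv; apply: contrapT => v0; apply: none; exists v.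
Qed.

Theorem Fock_module_exists_unique :
  exists! act : Usigma s n -> Fock K n -> Fock K n,
    is_module act /\ Fock_formulas x act.
Proof.
exists Fock_act; split.
  by split; [exact: Fock_act_is_module | exact: Fock_act_formulas].
move=> act [mod form]; apply/funext => a; apply/funext => v.
exact (Fock_module_unique Fock_act_is_module Fock_act_formulas mod form a v).
Qed.

End FockData.

(** * The generic parameter *)

Lemma qhalf_neq0 : qhalf != 0.
Proof. by rewrite /qhalf tofrac_eq0 polyX_eq0. Qed.

Lemma qhalf_not_root_of_unity k : (0 < k)%N -> qhalf ^+ k != 1.
Proof.
move=> k0; rewrite /qhalf -tofracXn -tofrac1 tofrac_eq.
apply/eqP => /(congr1 (size : {poly rat} -> nat)).
by rewrite size_polyXn size_poly1; case: k k0.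
Qed.

Theorem proposition3p14 (n : nat) (hn : (2 <= n)%N) (x : Qqh) (hx : x != 0) :
  (exists! act : Usigma qhalf n -> Fock Qqh n -> Fock Qqh n,
      is_module act /\ Fock_formulas x act) /\
  (forall act : Usigma qhalf n -> Fock Qqh n -> Fock Qqh n,
      is_module act -> Fock_formulas x act -> irreducible_module act).
Proof.
split.
  exact (Fock_module_exists_unique qhalf_neq0 qhalf_not_root_of_unity hx hn).
exact (Fock_irreducible qhalf_neq0 qhalf_not_root_of_unity hx hn).
Qed.
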